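(* Let $d\ge 1$ and let $\maltese_d$ be the star graph with a central vertex $0$ of degree $d$ joined to $d$ vertices $1,\dots,d$ (the petals), each of degree $1$. Then the equivalence classes of labelings of $\maltese_d$ are: (1) the class consisting only of the zero labeling; (2) for every $m$ with $0<2m\le d$, each of the $\binom{d}{2m}$ labelings in which the central vertex is labeled $0$ and exactly $2m$ petals are labeled $1$ is a fixed labeling (a class by itself); (3) one class consisting of all labelings with an odd number of components, represented by the labeling with the central vertex labeled $1$ and all petals labeled $0$. In particular the number of classes is $1+\binom{d}{2}+\binom{d}{4}+\dots+\binom{d}{2\lfloor d/2\rfloor}+1=2^{d-1}+1$.
   Context: Reeder's puzzle on a finite connected simple graph $D$: a labeling is a vector $a=(a_i)$ with $a_i\in\mathbb{Z}/2\mathbb{Z}$ for each vertex $i$. The move $T_i$ sends $a$ to $a'$ with $a'_j=a_j$ for $j\neq i$ and $a'_i=a_i+\sum_k a_k \pmod 2$, summing over the neighbors $k$ of $i$. Two labelings are equivalent if one is obtained from the other by a finite sequence of moves. A labeling is fixed if $T_i(a)=a$ for all $i$. The components of a labeling are the connected components of the subgraph induced on the vertices labeled $1$. *)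

(* Defs.v *)
From HB Require Import structures.
From mathcomp Require Import all_boot all_order all_algebra.
Set Implicit Arguments.
Unset Strict Implicit.
Unset Printing Implicit Defensive.
Import GRing.Theory.

(* A finite connected simple graph is given by its adjacency relation. *)
Definition connected_simple_graph (V : finType) (e : rel V) : Prop :=
  [/\ symmetric e, irreflexive e & forall x y, connect e x y].

Notation labeling V := {ffun V -> 'Z_2}.

Section Puzzle.
Variables (V : finType) (e : rel V).
Implicit Types a b : labeling V.

Definition move (i : V) a : labeling V :=
  [ffun j => if j == i then (a i + \sum_(k | e i k) a k)%R else a j].

Definition lequiv : rel (labeling V) :=
  connect [rel a b | [exists i, b == move i a]].

Definition fixed_labeling a : Prop := forall i, move i a = a.

Definition classes : {set {set labeling V}} :=
  equivalence_partition lequiv [set: labeling V].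

Definition support1 a : {set V} := [set i | a i == 1%R].

Definition induced (A : {set V}) : rel V :=
  [rel x y | [&& x \in A, y \in A & e x y]].

Definition components a : {set {set V}} :=
  equivalence_partition (connect (induced (support1 a))) (support1 a).

Lemma lequivP a b :
  reflect (exists s : seq V, b = foldl (fun c i => move i c) a s) (lequiv a b).
Proof.
apply: (iffP connectP) => [[p]|[s ->]].
  elim: p a => [|c p IHp] a /=; first by move=> _ ->; exists [::].
  case/andP=> /existsP[i /eqP->] /IHp H /H[s ->].
  by exists (i :: s).
elim: s a => [|i s IHs] a /=; first by exists [::].
have [p pP ->] := IHs (move i a).
by exists (move i a :: p) => //=; rewrite pP andbT; apply/existsP; exists i.
Qed.

Lemma moveK i : irreflexive e -> involutive (move i).
Proof.
move=> e_irr a; apply/ffunP=> j; rewrite ffunE.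
case: eqP => [->|/eqP/negbTE nji]; last by rewrite ffunE nji.
have -> : (\sum_(k | e i k) move i a k = \sum_(k | e i k) a k)%R.
  apply: eq_bigr => k eik; rewrite ffunE.
  by case: eqP => // eki; rewrite eki e_irr in eik.
rewrite ffunE eqxx -addrA -[X in (_ + X)%R]mulr2n -mulr_natr.
by rewrite (_ : 2%:R = 0 :> 'Z_2)%R ?mulr0 ?addr0 //; apply/val_inj.
Qed.

Lemma lequiv_equivalence : irreflexive e -> equivalence_rel lequiv.
Proof.
move=> e_irr; apply/equivalence_relP; split; first exact: connect0.
apply: left_trans; last exact: connect_trans.
apply: sym_connect_sym => a b /=.
by apply/existsP/existsP=> -[i /eqP->]; exists i; rewrite moveK.
Qed.

End Puzzle.

(* The center is ord0; the petals are the other elements of 'I_d.+1. *)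
Definition star (d : nat) : rel 'I_d.+1 :=
  fun i j => (i == ord0) (+) (j == ord0).

Lemma star_connected_simple d : connected_simple_graph (@star d).
Proof.
have sS : symmetric (@star d) by move=> i j; rewrite /star addbC.
split=> // [i|x y]; first by rewrite /star addbb.
have c0 z : connect (@star d) ord0 z.
  have [->|nz] := eqVneq z ord0; first exact: connect0.
  by apply: connect1; rewrite /star eqxx (negbTE nz).
by apply: connect_trans (c0 y); rewrite (sym_connect_sym sS).
Qed.

Definition zero_labeling (d : nat) : labeling 'I_d.+1 := [ffun=> 0%R].

Definition center_labeling (d : nat) : labeling 'I_d.+1 :=
  [ffun i => if i == ord0 then 1%R else 0%R].

Definition petal_labelings (d k : nat) : {set labeling 'I_d.+1} :=
  [set a : labeling 'I_d.+1 |
    (a ord0 == 0%R) && (#|[set i | (i != ord0) && (a i == 1%R)]| == k)].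

Definition odd_labelings (d : nat) : {set labeling 'I_d.+1} :=
  [set a : labeling 'I_d.+1 | odd #|components (@star d) a|].

(* Main.v *)
Require Import Defs.
From mathcomp Require Import all_boot all_order all_algebra.

Set Implicit Arguments.
Unset Strict Implicit.
Unset Printing Implicit Defensive.
Import GRing.Theory.

(* If the center is labeled 0, petal moves do nothing, and the center move adds
   the parity of the number of petals labeled 1: such a labeling is fixed when
   this parity is even.  If the center is labeled 1, each petal move flips that
   petal, so all these labelings are equivalent, and one center move joins to
   them the labelings with center 0 and an odd number of petals labeled 1.
   A labeling with center 1 has one component, and a labeling with center 0 has
   as many components as petals labeled 1. *)

(** * Arithmetic modulo 2 and sums of even binomial coefficients *)

Lemma Z2_cases (x : 'Z_2) : (x = 0 \/ x = 1)%R.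
Proof. by case: x => -[|[|//]] ltx; [left | right]; apply/val_inj. Qed.

Lemma Z2_eqb (b : bool) : ((b%:R : 'Z_2) == 1)%R = b.
Proof. by case: b. Qed.

Lemma Z2_natr (n : nat) : (n%:R = (odd n)%:R :> 'Z_2)%R.
Proof.
elim: n => [//|n IHn]; rewrite oddS mulrSr IHn.
by case: (odd n); apply/val_inj.
Qed.

Lemma sum_Z2 (T : finType) (P : pred T) (a : labeling T) :
  (\sum_(k | P k) a k)%R = (#|[set k | P k && (a k == 1%R)]|%:R)%R.
Proof.
rewrite -sum1dep_card natr_sum big_mkcondr /=.
by apply: eq_bigr => k _; case: (Z2_cases (a k)) => ->.
Qed.

(** By Pascal's rule, each term with [m > 0] splits into the entries [2 * m - 1] and [2 * m] of row
    [n]; these consecutive pairs, after the entry 0, exhaust an initial segment of the row. *)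
Lemma sum_bin_even (n M : nat) :
  \sum_(0 <= m < M.+1) 'C(n.+1, 2 * m) = \sum_(0 <= i < (2 * M).+1) 'C(n, i).
Proof.
elim: M => [|M IHM]; first by rewrite !big_nat1 !bin0.
rewrite big_nat_recr //= IHM mulnS !addSn add0n binS.
by rewrite !(big_nat_recr (2 * M).+1.+1, big_nat_recr (2 * M).+1) //= addnA addnAC.
Qed.

Lemma sum_bin_even_half (n : nat) :
  \sum_(0 <= m < n.+1./2.+1) 'C(n.+1, 2 * m) = 2 ^ n.
Proof.
(* The upper index [2 * n.+1./2] is [n] or [n.+1], so the whole row [n] is covered; cutting at
   [n.+1] isolates a possible extra term, which vanishes. The row sum is the expansion of
   [(1 + 1) ^ n]. *)
rewrite sum_bin_even (@big_cat_nat _ _ _ n.+1) //=; last first.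
  by rewrite ltnS mul2n -leq_uphalf_double.
rewrite [X in _ + X]big_nat [X in _ + X]big1 ?addn0 => [|i /andP[ltni _]];
  last exact: bin_small.
rewrite big_mkord -[in RHS](addn1 1) expnDn.
by apply: eq_bigr => i _; rewrite !exp1n !muln1.
Qed.

Lemma card_even_sets (T : finType) :
  #|[set A : {set T} | ~~ odd #|A|]|
    = \sum_(0 <= m < #|T|./2.+1) 'C(#|T|, 2 * m).
Proof.
rewrite -sum1_card big_mkord.
(* The even sets are grouped by half their size, so that the group of index [m] is the family of all
   [2 * m]-element subsets. *)
rewrite (partition_big (fun A : {set T} => inord #|A|./2 : 'I_#|T|./2.+1) xpredT) //=.
apply: eq_bigr => m _; rewrite sum1dep_card -card_draws.
apply: eq_card => A; rewrite !inE -val_eqE /= inordK ?ltnS ?half_leq ?max_card //.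
apply/andP/eqP => [[evA /eqP <-]|->].
  by rewrite mul2n even_halfK.
by rewrite mul2n odd_double doubleK.
Qed.

(** * Effect of the moves on the star *)

Section Star.
Variable d : nat.
Implicit Types a b : labeling 'I_d.+1.
Notation star := (@star d).

Definition petals1 a : {set 'I_d.+1} := [set i | (i != ord0) && (a i == 1%R)].

(** Treats the zero labeling and all the families of case (2) at once. *)
Definition even_labelings : {set labeling 'I_d.+1} :=
  [set a : labeling 'I_d.+1 | (a ord0 == 0%R) && ~~ odd #|petals1 a|].

Lemma star0 (k : 'I_d.+1) : star ord0 k = (k != ord0).
Proof. by rewrite /Defs.star eqxx. Qed.

Lemma move_center a : move star ord0 a ord0 = (a ord0 + (odd #|petals1 a|)%:R)%R.
Proof.
by rewrite ffunE eqxx -Z2_natr sum_Z2.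
Qed.

(** The center is the only neighbor of a petal, so the neighbor sum has a single term. *)
Lemma move_petal a i : i != ord0 ->
  move star i a = [ffun j => if j == i then (a i + a ord0)%R else a j].
Proof.
move=> ni0; apply/ffunP=> j; rewrite !ffunE; case: eqP => // _.
by congr (_ + _)%R; apply: big_pred1 => k; rewrite /Defs.star (negbTE ni0).
Qed.

Lemma even_labeling_fixed a : a \in even_labelings -> fixed_labeling star a.
Proof.
rewrite inE => /andP[/eqP a0 ev] i; apply/ffunP=> j.
have [->|ni0] := eqVneq i ord0.
  have [->|nj0] := eqVneq j ord0; first by rewrite move_center (negbTE ev) addr0.
  by rewrite ffunE (negbTE nj0).
by rewrite move_petal // ffunE a0 addr0; case: eqP => // ->.
Qed.

Lemma fixed_lequiv a b : fixed_labeling star a -> lequiv star a b = (b == a).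
Proof.
move=> fa; apply/lequivP/eqP => [[s ->]|->]; last by exists [::].
by elim: s => //= i s; rewrite fa.
Qed.

Lemma lequiv_sym : symmetric (lequiv star).
Proof.
have [_ irr _] := star_connected_simple d.
(* Left transitivity [t] turns [h] into an equality of rows of the relation, which reduces the goal
   to reflexivity [r]. *)
by case/equivalence_relP: (lequiv_equivalence irr) => r t x y; apply/idP/idP => h;
  rewrite -(t _ _ h) r.
Qed.

Lemma lequiv_move a i : lequiv star a (move star i a).
Proof. by apply/lequivP; exists [:: i]. Qed.

(** * Counting components *)

Lemma inducedE (A : {set 'I_d.+1}) x y :
  induced star A x y = [&& x \in A, y \in A & star x y].
Proof. by []. Qed.

(** Every other vertex of the support is adjacent to the center, which also lies in it, so the
    support is connected. *)
Lemma components_center1 a : a ord0 = 1%R -> #|components star a| = 1.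
Proof.
move=> a1; suff -> : components star a = [set support1 a] by rewrite cards1.
have s0 : ord0 \in support1 a by rewrite inE a1.
have [symS _ _] := star_connected_simple d.
have symI : symmetric (induced star (support1 a)).
  by move=> x y; rewrite !inducedE andbCA symS.
have c0 x : x \in support1 a -> connect (induced star (support1 a)) ord0 x.
  move=> sx; have [->|nx0] := eqVneq x ord0; first exact: connect0.
  by apply: connect1; rewrite inducedE s0 sx star0.
have cl x : x \in support1 a ->
    [set y in support1 a | connect (induced star (support1 a)) x y] = support1 a.
  move=> sx; apply/setP=> y; rewrite inE; case sy: (y \in _) => //=.
  by rewrite (connect_trans _ (c0 y sy)) // (sym_connect_sym symI) c0.
apply/setP=> C; rewrite inE; apply/imsetP/eqP => [[x sx ->]|->]; first exact: cl.
by exists ord0; rewrite ?cl.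
Qed.

(** Every edge of the star meets the center, so the support carries no edge and its components are
    singletons. *)
Lemma components_center0 a : a ord0 = 0%R -> #|components star a| = #|petals1 a|.
Proof.
move=> a0.
have eqS : support1 a = petals1 a.
  apply/setP=> i; rewrite !inE; have [->|//] := eqVneq i ord0.
  by rewrite a0.
have noedge x y : induced star (support1 a) x y = false.
  rewrite inducedE eqS !inE /Defs.star.
  by case: (x == ord0); case: (y == ord0); rewrite ?andbF.
have conE x y : connect (induced star (support1 a)) x y = (y == x).
  apply/idP/eqP => [/connectP[[|z p]]|->]; last exact: connect0.
    by move=> _ ->.
  by rewrite [path _ _ _]/= noedge.
rewrite -eqS /components /equivalence_partition card_in_imset // => x y sx sy.
move/setP/(_ x); rewrite !inE !conE eqxx.
by move: sx; rewrite inE => ->; rewrite andTb => /esym/eqP.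
Qed.

Lemma odd_labelingsE : odd_labelings d = ~: even_labelings.
Proof.
apply/setP=> a; rewrite !inE; case: (Z2_cases (a ord0)) => a0; rewrite a0.
  by rewrite components_center0 // eqxx negbK.
by rewrite components_center1.
Qed.

(** Induction on the number of petals labeled 1: a move at such a petal clears it and leaves the
    center at 1. *)
Lemma lequiv_center1 a : a ord0 = 1%R -> lequiv star a (center_labeling d).
Proof.
move: {2}#|_| (erefl #|petals1 a|) => n; elim: n a => [|n IHn] a cn a1.
  suff -> : a = center_labeling d by apply: connect0.
  apply/ffunP=> i; rewrite ffunE; case: eqP => [->//|/eqP ni0].
  move/eqP: cn; rewrite cards_eq0 => /eqP/setP/(_ i).
  by rewrite !inE ni0; case: (Z2_cases (a i)) => ->.
have /card_gt0P[i] : 0 < #|petals1 a| by rewrite cn.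
rewrite inE => /andP[ni0 /eqP ai].
apply: connect_trans (lequiv_move a i) _; apply: IHn; last first.
  by rewrite move_petal // ffunE eq_sym (negbTE ni0).
apply/eqP; rewrite -eqSS -cn (cardsD1 i (petals1 a)) inE ni0 ai add1n eqSS.
apply/eqP/eq_card => j; rewrite !inE move_petal // ffunE.
by have [->|//] := eqVneq j i; rewrite ai a1 andbF.
Qed.

Lemma lequiv_center a : a \in odd_labelings d -> lequiv star a (center_labeling d).
Proof.
rewrite odd_labelingsE !inE; case: (Z2_cases (a ord0)) => [a0|a1 _].
  rewrite a0 eqxx negbK => od.
  apply: connect_trans (lequiv_move a ord0) _; apply: lequiv_center1.
  by rewrite move_center a0 od add0r.
exact: lequiv_center1.
Qed.

(** * Determination of the classes *)

Definition lclass a : {set labeling 'I_d.+1} := [set b | lequiv star a b].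

Lemma classesE : classes star = lclass @: setT.
Proof.
by apply: eq_imset => a; apply/setP=> b; rewrite !inE.
Qed.

Lemma lclass_even a : a \in even_labelings -> lclass a = [set a].
Proof.
by move=> ea; apply/setP=> b; rewrite !inE fixed_lequiv //; apply: even_labeling_fixed.
Qed.

Lemma lclass_odd a : a \in odd_labelings d -> lclass a = odd_labelings d.
Proof.
move=> oa; apply/setP=> b; rewrite inE; apply/idP/idP => [ab|ob].
  rewrite odd_labelingsE inE; apply/negP=> eb.
  (* Symmetry puts the even labeling [b] first: being fixed, it reaches only itself, which forces
     [a = b] and contradicts that [a] is odd. *)
  move: ab; rewrite lequiv_sym fixed_lequiv; last exact: even_labeling_fixed.
  by move/eqP=> eab; move: oa; rewrite odd_labelingsE inE eab eb.
apply: connect_trans (lequiv_center oa) _.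
by rewrite -/(lequiv _ _ _) lequiv_sym lequiv_center.
Qed.

Lemma center_odd : center_labeling d \in odd_labelings d.
Proof. by rewrite odd_labelingsE !inE ffunE eqxx. Qed.

Lemma classes_star : classes star = odd_labelings d |: set1 @: even_labelings.
Proof.
rewrite classesE; apply/setP=> C; rewrite !inE; apply/imsetP/orP.
  case=> a _ ->; case ea: (a \in even_labelings).
    by right; rewrite lclass_even //; apply: imset_f.
  by left; rewrite lclass_odd // odd_labelingsE inE ea.
case=> [/eqP->|/imsetP[a ea ->]].
  by exists (center_labeling d); rewrite ?lclass_odd ?center_odd.
by exists a; rewrite ?lclass_even.
Qed.

Lemma card_classes_star : #|classes star| = #|even_labelings|.+1.
Proof.
rewrite classes_star cardsU1 card_imset; last exact: set1_inj.
(* The odd class is none of the singletons: otherwise the even labeling [a] would belong to it. *)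
rewrite (_ : _ \notin _) //; apply/imsetP=> -[a ea E].
by have := set11 a; rewrite -E odd_labelingsE inE ea.
Qed.

(** * Counting labelings through subsets of the petals *)

Definition petal_labeling (A : {set 'I_d}) : labeling 'I_d.+1 :=
  [ffun i => if unlift ord0 i is Some j then ((j \in A)%:R)%R else 0%R].

Lemma petal_labeling0 A : petal_labeling A ord0 = 0%R.
Proof. by rewrite ffunE unlift_none. Qed.

Lemma petal_labeling_lift A j :
  petal_labeling A (lift ord0 j) = ((j \in A)%:R)%R.
Proof. by rewrite ffunE liftK. Qed.

Lemma petals1_petal_labeling A : petals1 (petal_labeling A) = lift ord0 @: A.
Proof.
apply/setP=> i; rewrite inE; case: (unliftP ord0 i) => [j|] ->.
  by rewrite petal_labeling_lift Z2_eqb (mem_imset _ _ (@lift_inj _ _)) eq_sym neq_lift.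
by rewrite eqxx; apply/esym/imsetP=> -[j _ /eqP]; rewrite (negbTE (neq_lift _ _)).
Qed.

Lemma petal_labeling_inj : injective petal_labeling.
Proof.
move=> A B eAB; apply/setP=> j.
by rewrite -[LHS]Z2_eqb -[RHS]Z2_eqb -!petal_labeling_lift eAB.
Qed.

(** Stated for an arbitrary [P] to serve both counts: exactly [k] petals, and an even number of
    petals. *)
Lemma card_center0_labelings (P : pred nat) :
  #|[set a : labeling 'I_d.+1 | (a ord0 == 0%R) && P #|petals1 a|]|
    = #|[set A : {set 'I_d} | P #|A|]|.
Proof.
rewrite -[RHS](card_imset _ petal_labeling_inj); apply: eq_card => a.
rewrite inE; apply/andP/imsetP => [[/eqP a0 Pa]|[A]]; last first.
  rewrite inE => PA ->; rewrite petal_labeling0 petals1_petal_labeling.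
  by rewrite card_imset //; exact: lift_inj.
have aE : a = petal_labeling [set j | a (lift ord0 j) == 1%R].
  apply/ffunP=> i; case: (unliftP ord0 i) => [j|] ->; last by rewrite petal_labeling0.
  by rewrite petal_labeling_lift inE; case: (Z2_cases (a (lift ord0 j))) => ->.
exists [set j | a (lift ord0 j) == 1%R] => //.
move: Pa; rewrite {1}aE petals1_petal_labeling inE card_imset //.
exact: lift_inj.
Qed.

Lemma card_petal_labelings k : #|petal_labelings d k| = 'C(d, k).
Proof.
rewrite (card_center0_labelings (pred1 k)).
by rewrite (card_draws 'I_d) card_ord.
Qed.

Lemma card_even_labelings :
  #|even_labelings| = \sum_(0 <= m < d./2.+1) 'C(d, 2 * m).
Proof.
rewrite (card_center0_labelings (fun n => ~~ odd n)).
by rewrite card_even_sets card_ord.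
Qed.

Lemma petal_labelings_even m a :
  a \in petal_labelings d (2 * m) -> a \in even_labelings.
Proof.
by rewrite !inE => /andP[-> /eqP ca]; rewrite /petals1 ca mul2n odd_double.
Qed.

Lemma zero_even : zero_labeling d \in even_labelings.
Proof.
rewrite inE ffunE eqxx (_ : petals1 _ = set0) ?cards0 //.
by apply/setP=> i; rewrite !inE ffunE andbF.
Qed.

Lemma card_petals1_le a : #|petals1 a| <= d.
Proof.
have : petals1 a \subset [set~ ord0] by apply/subsetP=> i; rewrite !inE => /andP[].
by move/subset_leq_card; rewrite cardsC1 card_ord.
Qed.

Lemma even_labelings_petal a : a \in even_labelings ->
  a = zero_labeling d \/
  exists2 m, 0 < 2 * m <= d & a \in petal_labelings d (2 * m).
Proof.
rewrite inE => /andP[a0 ev].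
have [c0|c0] := posnP #|petals1 a|; [left | right].
  apply/ffunP=> i; rewrite ffunE; have [->|ni0] := eqVneq i ord0; first exact/eqP.
  move/eqP: c0; rewrite cards_eq0 => /eqP/setP/(_ i).
  by rewrite !inE ni0; case: (Z2_cases (a i)) => ->.
(* Evenness makes twice this half equal to the number of petals labeled 1. *)
exists #|petals1 a|./2; rewrite mul2n even_halfK //.
  by rewrite c0 card_petals1_le.
by rewrite inE a0 /= -/(petals1 a) eqxx.
Qed.

End Star.

Theorem theorem3p15 (d : nat) (d_ge1 : 1 <= d) :
  [/\ [set zero_labeling d] \in classes (@star d),
      forall m : nat, 0 < 2 * m <= d ->
        #|petal_labelings d (2 * m)| = 'C(d, 2 * m) /\
        (forall a, a \in petal_labelings d (2 * m) ->
           fixed_labeling (@star d) a /\ [set a] \in classes (@star d)),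
      odd_labelings d \in classes (@star d) /\
        center_labeling d \in odd_labelings d,
      forall C : {set labeling 'I_d.+1}, C \in classes (@star d) ->
        [\/ C = [set zero_labeling d],
            exists m : nat, 0 < 2 * m <= d /\
              (exists2 a, a \in petal_labelings d (2 * m) & C = [set a])
          | C = odd_labelings d]
    & #|classes (@star d)| = 1 + \sum_(1 <= m < d./2.+1) 'C(d, 2 * m) + 1 /\
      1 + \sum_(1 <= m < d./2.+1) 'C(d, 2 * m) + 1 = 2 ^ (d - 1) + 1].
Proof.
have singl a : a \in even_labelings d -> [set a] \in classes (@star d).
  by move=> ea; rewrite classes_star inE imset_f ?orbT.
(* The leading 1 is the term [m = 0], which accounts for the zero labeling. *)
have sum0 : 1 + \sum_(1 <= m < d./2.+1) 'C(d, 2 * m)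
    = \sum_(0 <= m < d./2.+1) 'C(d, 2 * m).
  by rewrite [RHS]big_ltn // muln0 bin0.
split.
- exact/singl/zero_even.
- move=> m _; split=> [|a /petal_labelings_even ea]; first exact: card_petal_labelings.
  by split; [apply: even_labeling_fixed | apply: singl].
- by rewrite center_odd classes_star setU11.
- move=> C; rewrite classes_star !inE => /orP[/eqP->|/imsetP[a ea ->]].
    by constructor 3.
  have [->|[m md pa]] := even_labelings_petal ea; first by constructor 1.
  by constructor 2; exists m; split=> //; exists a.
- rewrite sum0 card_classes_star card_even_labelings addn1; split=> //.
  (* With [d = n.+1], the exponent [d - 1] becomes [n]. *)
  by rewrite addn1; case: d d_ge1 {singl sum0} => // n _; rewrite sum_bin_even_half subn1.
Qed.
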